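(* Let $p$ be a prime and let $\phi(x)=\frac{ax+b}{cx+d}$ with $a,b,c,d\in\mathbb{Q}_p$, $ad-bc\neq 0$, regarded as a map $\mathbb{P}^1(\mathbb{Q}_p)\to\mathbb{P}^1(\mathbb{Q}_p)$. Suppose that $\phi$ has no fixed point in $\mathbb{P}^1(\mathbb{Q}_p)$ and that $\phi^n\neq \mathrm{id}$ for all integers $n>0$. Then the minimal subsystems of $\phi$ are topologically conjugate to the adding machine on the odometer $\mathbb{Z}_{(p_s)}$, where $(p_s)=(k,kp,kp^2,\cdots)$ for some $k\mid (p+1)$.
   Context: $\mathbb{P}^1(\mathbb{Q}_p)=\mathbb{Q}_p\cup\{\infty\}$ with its usual compact topology. A subsystem is a pair $(E,\phi)$ with $E\subset \mathbb{P}^1(\mathbb{Q}_p)$ nonempty compact and $\phi(E)\subset E$; it is minimal if $E=\overline{\{\phi^n(x):n\ge 0\}}$ for every $x\in E$. For a sequence $(p_s)_{s\ge1}$ of positive integers with $p_s\mid p_{s+1}$ for every $s$, the odometer $\mathbb{Z}_{(p_s)}$ is the inverse limit of $\mathbb{Z}/p_s\mathbb{Z}$, and the adding machine on it is the map $x\mapsto x+1$. *)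

(* Defs.v *)
From HB Require Import structures.
From mathcomp Require Import all_boot all_order all_algebra.
From mathcomp Require Import all_classical topology.

Set Implicit Arguments.
Unset Strict Implicit.
Unset Printing Implicit Defensive.

Import Order.TTheory GRing.Theory Num.Theory.

Local Open Scope classical_set_scope.
Local Open Scope ring_scope.

Record odometer_scale := OdometerScale {
  scale :> nat -> nat;
  scale_gt0 : forall s, (0 < scale s)%N;
  scale_dvd : forall s, (scale s %| scale s.+1)%N }.

(* The class in Z/q_s of the s-th coordinate of a point of the inverse limit
   is represented by its least residue; plain nat is used rather than 'Z_n,
   which is not Z/n for n = 1. *)
Record odometer (q : odometer_scale) := Odometer {
  ocoord :> nat -> nat;
  _ : `[< forall s, (ocoord s < q s)%N /\ ocoord s = (ocoord s.+1 %% q s)%N >] }.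

HB.instance Definition _ q := [isSub for @ocoord q].
HB.instance Definition _ q := [Choice of odometer q by <:].

(* Subspace topology of the product of the discrete spaces nat; the s-th
   coordinate takes its values in the finite set {0, ..., q_s - 1}. *)
HB.instance Definition _ (q : odometer_scale) := Topological.copy (odometer q)
  (initial_topology
     (@ocoord q : odometer q -> prod_topology (fun _ : nat => nat))).

Section OdometerRing.
Variable q : odometer_scale.
Implicit Types x y z : odometer q.

Lemma ocoord_lt x s : (x s < q s)%N.
Proof. by case: x => f /= /asboolP/(_ s)[]. Qed.

Lemma ocoord_mod x s : (x s.+1 %% q s)%N = x s.
Proof. by case: x => f /= /asboolP/(_ s)[]. Qed.

Lemma ocoord_small x s : (x s %% q s)%N = x s.
Proof. by rewrite modn_small // ocoord_lt. Qed.

Lemma odometerP x y : (forall s, x s = y s) -> x = y.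
Proof. by move=> xy; apply/val_inj/funext. Qed.

Fact odometer_of_subproof (f : nat -> nat) :
  (forall s, f s.+1 = f s %[mod q s])%N ->
  `[< forall s, (f s %% q s < q s)%N /\
        f s %% q s = (f s.+1 %% q s.+1) %% q s >]%N.
Proof.
move=> fq; apply/asboolP => s; split; first by rewrite ltn_mod scale_gt0.
by rewrite modn_dvdm ?scale_dvd.
Qed.

Definition odometer_of f fq : odometer q :=
  Odometer (@odometer_of_subproof f fq).

Fact oconst_subproof (n : nat) s : (n = n %[mod q s])%N.
Proof. by []. Qed.
Definition oconst n := odometer_of (oconst_subproof n).

Fact oadd_subproof x y s : (x s.+1 + y s.+1 = x s + y s %[mod q s])%N.
Proof. by rewrite -modnDm !ocoord_mod. Qed.
Definition oadd x y := odometer_of (oadd_subproof x y).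

Fact oopp_subproof x s : (q s.+1 - x s.+1 = q s - x s %[mod q s])%N.
Proof.
apply/eqP; rewrite -(eqn_modDr (x s)) subnK ?(ltnW (ocoord_lt _ _)) // modnn.
rewrite -[X in (_ + X)%N](ocoord_mod x) modnDmr.
by rewrite subnK ?(ltnW (ocoord_lt _ _)) // -/(dvdn _ _) scale_dvd.
Qed.
Definition oopp x := odometer_of (oopp_subproof x).

Fact omul_subproof x y s : (x s.+1 * y s.+1 = x s * y s %[mod q s])%N.
Proof. by rewrite -modnMm !ocoord_mod. Qed.
Definition omul x y := odometer_of (omul_subproof x y).

Fact oaddA : associative oadd.
Proof.
by move=> x y z; apply: odometerP => s /=; rewrite modnDmr modnDml addnA.
Qed.

Fact oaddC : commutative oadd.
Proof. by move=> x y; apply: odometerP => s /=; rewrite addnC. Qed.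

Fact oadd0 : left_id (oconst 0) oadd.
Proof.
by move=> x; apply: odometerP => s /=; rewrite mod0n add0n ocoord_small.
Qed.

Fact oaddN : left_inverse (oconst 0) oopp oadd.
Proof.
move=> x; apply: odometerP => s /=.
by rewrite modnDml subnK ?(ltnW (ocoord_lt _ _)) // modnn mod0n.
Qed.

HB.instance Definition _ :=
  GRing.isZmodule.Build (odometer q) oaddA oaddC oadd0 oaddN.

Fact omulA : associative omul.
Proof.
by move=> x y z; apply: odometerP => s /=; rewrite modnMmr modnMml mulnA.
Qed.

Fact omulC : commutative omul.
Proof. by move=> x y; apply: odometerP => s /=; rewrite mulnC. Qed.

Fact omul1 : left_id (oconst 1) omul.
Proof.
by move=> x; apply: odometerP => s /=; rewrite modnMml mul1n ocoord_small.
Qed.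

Fact omulDl : left_distributive omul oadd.
Proof.
by move=> x y z; apply: odometerP => s /=; rewrite modnMml modnDm mulnDl.
Qed.

HB.instance Definition _ :=
  GRing.Zmodule_isComPzRing.Build (odometer q) omulA omulC omul1 omulDl.

Definition adding_machine (x : odometer q) : odometer q := x + 1.

End OdometerRing.

Section Padic.
Variables (p : nat) (p_pr : prime p).

Fact ppow_gt0 s : (0 < p ^ s)%N.
Proof. by rewrite expn_gt0 prime_gt0. Qed.

Fact ppow_dvd s : (p ^ s %| p ^ s.+1)%N.
Proof. by rewrite dvdn_exp2l. Qed.

Definition ppow_scale := OdometerScale ppow_gt0 ppow_dvd.

Definition padic_int := odometer ppow_scale.

HB.instance Definition _ := GRing.ComPzRing.on padic_int.
HB.instance Definition _ := Topological.on padic_int.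

Fact padic_int_oner_neq0 : (1 : padic_int) != 0.
Proof.
apply/eqP => /(congr1 (fun x : padic_int => x 1%N)) /=.
by rewrite mod0n expn1 modn_small // prime_gt1.
Qed.

HB.instance Definition _ :=
  GRing.PzSemiRing_isNonZero.Build padic_int padic_int_oner_neq0.

Definition padic_int_unit : pred padic_int :=
  fun x => `[< exists y, y * x = 1 >].
Definition padic_int_inv (x : padic_int) : padic_int :=
  if pselect (exists y, y * x = 1) is left ex then projT1 (cid ex) else x.

Fact padic_int_mulVr : {in padic_int_unit, left_inverse 1 padic_int_inv *%R}.
Proof.
move=> x /asboolP ex; rewrite /padic_int_inv.
by case: pselect => // ex'; case: cid.
Qed.

Fact padic_int_unitP (x y : padic_int) : y * x = 1 -> padic_int_unit x.
Proof. by move=> yx; apply/asboolP; exists y. Qed.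

Fact padic_int_inv_out : {in [predC padic_int_unit], padic_int_inv =1 id}.
Proof.
move=> x /asboolP nex; rewrite /padic_int_inv.
by case: pselect.
Qed.

HB.instance Definition _ := GRing.ComNzRing_hasMulInverse.Build padic_int
  padic_int_mulVr padic_int_unitP padic_int_inv_out.

Lemma padic_int_mod (x : padic_int) m n : (x (m + n) %% p ^ m)%N = x m.
Proof.
elim: n => [|n IHn]; first by rewrite addn0 (ocoord_small x).
rewrite addnS -[RHS]IHn -(ocoord_mod x (m + n)) modn_dvdm //=.
by rewrite dvdn_exp2l // leq_addr.
Qed.

Fact padic_int_mulf_eq0 (x y : padic_int) :
  x * y = 0 -> (x == 0) || (y == 0).
Proof.
move=> xy0; apply/negP => /negP; rewrite negb_or => /andP[x0 y0].
have neq0 (z : padic_int) : z != 0 -> exists m, z m <> 0%N.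
  move=> /eqP z0; apply/not_existsP => z_eq0; apply: z0.
  by apply: odometerP => s /=; rewrite mod0n; apply: contrapT; exact: z_eq0.
have [m xm] := neq0 _ x0; have [n yn] := neq0 _ y0.
have := congr1 (fun z : padic_int => z (m + n)%N) xy0 => /=.
rewrite mod0n => /eqP; rewrite -/(dvdn _ _).
have xmn : ~~ (p ^ m %| x (m + n)%N)%N by rewrite /dvdn padic_int_mod; exact/eqP.
have ymn : ~~ (p ^ n %| y (m + n)%N)%N.
  by rewrite addnC /dvdn padic_int_mod; exact/eqP.
have X0 : (0 < x (m + n)%N)%N by case: (x _) xmn; rewrite ?dvdn0.
have Y0 : (0 < y (m + n)%N)%N by case: (y _) ymn; rewrite ?dvdn0.
rewrite pfactor_dvdn ?muln_gt0 ?X0 // lognM //.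
move: xmn ymn; rewrite !pfactor_dvdn // -!ltnNge => xm' yn'.
by apply/negP; rewrite -ltnNge -addSn leq_add // ltnW.
Qed.

HB.instance Definition _ :=
  GRing.ComUnitRing_isIntegral.Build padic_int padic_int_mulf_eq0.

Definition padic := {fraction padic_int}.

HB.instance Definition _ := GRing.Field.on padic.

Definition padic_of_int (z : padic_int) : padic := @tofrac padic_int z.

Definition padic_ball (x : padic) (n : nat) : set padic :=
  [set x + p%:R ^+ n * padic_of_int z | z in [set: padic_int]].

Definition padic_nbhs (x : padic) : set_system padic :=
  filter_from [set: nat] (padic_ball x).

Lemma padic_ballS x m n : (m <= n)%N -> padic_ball x n `<=` padic_ball x m.
Proof.
move=> mn _ [z _ <-]; exists (p%:R ^+ (n - m) * z) => //.
by rewrite /padic_of_int rmorphM rmorphXn rmorph_nat mulrA -exprD subnKC.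
Qed.

Fact padic_nbhs_filter x : ProperFilter (padic_nbhs x).
Proof.
apply: filter_from_proper; last by move=> n _; exists (x + p%:R ^+ n * padic_of_int 0), 0.
apply: filter_from_filter; first by exists 0%N.
move=> m n _ _; exists (maxn m n) => // y xy.
by split; apply: padic_ballS xy; rewrite ?leq_maxl ?leq_maxr.
Qed.

Fact padic_nbhs_singleton x A : padic_nbhs x A -> A x.
Proof.
case=> n _; apply; exists 0 => //.
by rewrite /padic_of_int rmorph0 mulr0 addr0.
Qed.

Fact padic_nbhs_nbhs x A : padic_nbhs x A -> padic_nbhs x (padic_nbhs^~ A).
Proof.
case=> n _ xA; exists n => // _ [z _ <-]; exists n => // _ [t _ <-].
apply: xA; exists (z + t) => //.
by rewrite /padic_of_int rmorphD mulrDr addrA.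
Qed.

HB.instance Definition _ := hasNbhs.Build padic padic_nbhs.
HB.instance Definition _ := Nbhs_isNbhsTopological.Build padic
  padic_nbhs_filter padic_nbhs_singleton padic_nbhs_nbhs.

(* None is the point at infinity. *)
Definition padic_P1 := one_point_compactification padic.

HB.instance Definition _ := Topological.on padic_P1.

Definition homography (a b c d : padic) (x : padic_P1) : padic_P1 :=
  if x is Some t then
    if c * t + d == 0 then None else Some ((a * t + b) / (c * t + d))
  else if c == 0 then None else Some (a / c).

End Padic.

Section Dynamics.

Definition subsystem (X : topologicalType) (f : X -> X) (E : set X) : Prop :=
  [/\ E !=set0, compact E & f @` E `<=` E].

Definition orbit_closure (X : topologicalType) (f : X -> X) (x : X) : set X :=
  closure [set iter n f x | n in [set: nat]].

Definition minimal_subsystem (X : topologicalType) (f : X -> X) (E : set X) :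
    Prop :=
  subsystem f E /\ forall x, E x -> E = orbit_closure f x.

Definition topologically_conjugate (X Y : topologicalType)
    (E : set X) (f : X -> X) (F : set Y) (g : Y -> Y) : Prop :=
  exists (h : X -> Y) (h' : Y -> X),
    [/\ set_fun E F h /\ set_fun F E h',
        {within E, continuous h} /\ {within F, continuous h'},
        (forall x, E x -> h' (h x) = x) /\ (forall y, F y -> h (h' y) = y)
      & forall x, E x -> h (f x) = g (h x)].

End Dynamics.

(* Main.v *)
From HB Require Import structures.
Require Import Defs.
From mathcomp Require Import all_boot all_order all_algebra all_field.
From mathcomp Require Import all_classical topology.
From mathcomp Require Import generic_quotient zify ring.

(** Let [M] be the matrix of [phi] and [Q v = det (v, M v)], a binary quadratic
form whose zeros are the fixed points, so that [Q] is anisotropic over [Q_p].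
Since [Q (M v) = det M * Q v], the quantity
[dist (v, w) = det (v, w)^2 / (Q v * Q w)] is well defined on the projective
line and [phi]-invariant.  Anisotropy and Hensel's lemma give
[|B|^2 <= |Q v * Q w|] for the polar form [B] of [Q], and this makes [dist] an
ultrametric.  Moreover [dist (v, M^n v) = u_n^2 / (det M)^n] for the Lucas
sequence [u] of [M], independently of [v]; up to a nonzero constant factor it is
[t_n - 2], where [t_n = l^n + l^-n] is the [n]-th Chebyshev (Dickson) polynomial
in [t_1 = tr(M)^2 / det M - 2], a p-adic integer, and [l] is the ratio of the
eigenvalues of [M].  The Frobenius map gives [t_(p+1) = 2] mod [p], and each
multiplication of [n] by [p] improves the congruence [t_n = 2] by a factor [p].
Hence the times [n] at which [phi^n] is close to the identity are the multiples
of numbers [N_j] dividing [(p + 1) p^s], whose p'-parts stabilise at some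
[k | p + 1] while their p-parts are unbounded; the cosets of [N_j] then identify
every orbit closure with the odometer of scale [k p^s]. *)

Set Implicit Arguments.
Unset Strict Implicit.
Unset Printing Implicit Defensive.

Import Order.TTheory GRing.Theory Num.Theory.

Local Open Scope classical_set_scope.
Local Open Scope ring_scope.

(** * Chebyshev polynomials and periods *)

Section Chebyshev.
Variable R : comNzRingType.
Implicit Types t x y e : R.

(** Dickson normalisation: at t = x + 1/x the value is x^n + 1/x^n. *)
Fixpoint cheb t n {struct n} : R :=
  match n with
  | 0 => 2
  | n'.+1 => if n' is n''.+1 then t * cheb t n' - cheb t n'' else t
  end.

Arguments cheb : simpl never.

Lemma chebSS t n : cheb t n.+2 = t * cheb t n.+1 - cheb t n.
Proof. by []. Qed.

(** At t = x + 1/x this is the product formula for the sums x^i + x^-i, with indices shifted to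
    avoid subtraction. The second-order recurrence calls for induction on two consecutive [m]. *)
Lemma cheb_add2 t m k :
  cheb t (k + m + m) = cheb t m * cheb t (k + m) - cheb t k.
Proof.
suff: forall k, cheb t (k + m + m) = cheb t m * cheb t (k + m) - cheb t k /\
  cheb t (k + m.+1 + m.+1) = cheb t m.+1 * cheb t (k + m.+1) - cheb t k.
  by case/(_ k).
elim: m {k} => [|m IHm] k.
  by rewrite !addn0 !addn1 chebSS /=; split => //; ring.
split; first by case: (IHm k).
have [_] := IHm k.+1; have [+ _] := IHm k.+2.
rewrite !(addnS, addSn) [in X in _ -> _ -> X = _]chebSS => -> ->.
by rewrite (chebSS t m) (chebSS t k); ring.
Qed.

Lemma cheb_comp t m n : cheb (cheb t m) n = cheb t (m * n).
Proof.
suff: cheb (cheb t m) n = cheb t (m * n) /\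
      cheb (cheb t m) n.+1 = cheb t (m * n.+1) by case.
elim: n => [|n [IH0 IH1]]; first by rewrite muln0 muln1.
by split => //; rewrite chebSS IH0 IH1 !mulnSr cheb_add2.
Qed.

(** Taylor expansion at the fixed point 2, where the derivative is n^2. With [n = p] it improves a
    congruence to 2. *)
Lemma cheb_near2 e n :
  exists r, cheb (2 + e) n = 2 + n%:R ^+ 2 * e + e ^+ 2 * r.
Proof.
suff: (exists r, cheb (2 + e) n = 2 + n%:R ^+ 2 * e + e ^+ 2 * r) /\
  (exists r, cheb (2 + e) n.+1 = 2 + n.+1%:R ^+ 2 * e + e ^+ 2 * r) by case.
elim: n => [|n [[r IH0] [r' IH1]]].
  by split; exists 0; rewrite /cheb; ring.
split; first by exists r'.
exists (n.+1%:R ^+ 2 + 2 * r' + e * r' - r); rewrite chebSS IH0 IH1.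
by rewrite -[n.+2]addn2 -[n.+1]addn1 !natrD; ring.
Qed.

Lemma cheb_inv x y n : x * y = 1 -> cheb (x + y) n = x ^+ n + y ^+ n.
Proof.
move=> xy.
suff: cheb (x + y) n = x ^+ n + y ^+ n /\
      cheb (x + y) n.+1 = x ^+ n.+1 + y ^+ n.+1 by case.
elim: n => [|n [IH0 IH1]]; first by rewrite /cheb !expr0 !expr1.
split => //; rewrite chebSS IH0 IH1 !exprS.
by ring: xy.
Qed.

End Chebyshev.

Lemma cheb_morph (R S : comNzRingType) (f : {rmorphism R -> S}) (t : R) n :
  f (cheb t n) = cheb (f t) n.
Proof.
suff: f (cheb t n) = cheb (f t) n /\ f (cheb t n.+1) = cheb (f t) n.+1 by case.
elim: n => [|n [IH0 IH1]]; first by rewrite /cheb rmorph_nat.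
by split => //; rewrite !chebSS rmorphB rmorphM IH0 IH1.
Qed.

(* Over an algebraic closure write t = x + 1/x; Frobenius permutes {x, 1/x},
   so x ^ p is 1/x, giving x ^ (p + 1) = 1, or x itself lies in F_p. *)
Lemma cheb_Fp (p : nat) (p_pr : prime p) (t : 'F_p) :
  cheb t p.+1 = 2 \/ exists2 x : 'F_p, x ^+ 2 - t * x + 1 = 0 & x ^+ 2 != 1.
Proof.
have [K [f _]] := countable_algebraic_closure 'F_p.
have pK : p \in [pchar K].
  by rewrite (fmorph_pchar f) pchar_Fp.
have : exists x : K, x * (f t - x) = 1.
  have [//|x] :=
    @solve_monicpoly K 2 (fun i => if i == 0%N then -1 else f t).
  rewrite !big_ord_recl big_ord0 /= => xE; exists x.
  by move: xE; rewrite expr0 expr1 mulr1 addr0 => xE; ring: xE.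
case=> x; set y := f t - x => xy.
have fp z : f z ^+ p = f z.
  rewrite -rmorphXn; congr (f _).
  by have := expf_card z; rewrite card_Fp.
have xyp : x ^+ p * (f t - x ^+ p) = 1.
  rewrite -[f t]fp -!(pFrobenius_autE pK) -rmorphB -rmorphM /= -/y xy.
  exact: rmorph1.
(* By Frobenius, [x ^+ p] is again a root of X^2 - f(t) X + 1 = (X - x)(X - y). *)
have : (x ^+ p - x) * (x ^+ p - y) = 0.
  by rewrite -(subrr 1) -{1}xy -xyp /y; ring.
have ftE : f t = x + y by rewrite /y addrC subrK.
move=> /eqP; rewrite mulf_eq0 !subr_eq0 => /orP[]/eqP xp; last first.
  left; apply: (fmorph_inj f); rewrite cheb_morph ftE cheb_inv // rmorph_nat.
  have x1 : x ^+ p.+1 = 1 by rewrite exprSr xp mulrC.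
  suff -> : y ^+ p.+1 = 1 by rewrite x1.
  by rewrite -[LHS]mul1r -x1 -exprMn xy expr1n.
(* X^p - X is the product of all X - f(z), so its root x comes from the prime field. *)
have [z zE] : exists z, x = f z.
  have /(congr1 (fun q => (map_poly f q).[x])) := finField_genPoly 'F_p.
  rewrite card_Fp // rmorphB rmorph_prod /= map_polyXn map_polyX !hornerE.
  rewrite xp subrr horner_prod => /esym/eqP/prodf_eq0[z _].
  rewrite rmorphB /= map_polyX map_polyC !hornerE subr_eq0 => /eqP.
  by exists z.
have ztz : z * (t - z) = 1.
  by apply: (fmorph_inj f); rewrite rmorphM rmorphB rmorph1 -zE.
(* A double root belongs to the first alternative: then t = 2z and z^(p+1) = z^2 = 1. *)
have [z1|z1] := eqVneq (z ^+ 2) 1; last first.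
  by right; exists z => //; rewrite -(subrr 1) -{3}ztz; ring.
left; have tz : t = z + z.
  apply/eqP; rewrite -subr_eq; apply/eqP.
  by rewrite -[LHS]mulr1 -z1 expr2 mulrCA mulrA ztz mul1r.
rewrite {1}tz cheb_inv -?expr2 // exprSr.
by have := expf_card z; rewrite card_Fp // => ->; rewrite -expr2 z1.
Qed.

(** * Periods of a decreasing family of sets of return times *)

Section Arithmetic.
Variables (p m : nat) (P : nat -> nat -> Prop).
Hypotheses (p_pr : prime p) (m_gt0 : (0 < m)%N).
Hypothesis P0 : forall j, P j 0.
Hypothesis Pdecr : forall i j n, (i <= j)%N -> P j n -> P i n.
Hypothesis Padd : forall j a b, P j a -> (P j (a + b) <-> P j b).
Hypothesis Psep : forall n, (0 < n)%N -> exists j, ~ P j n.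
Hypothesis Pcvg : forall j, exists s, P j (m * p ^ s)%N.

(** By [Padd] the set is stable under sums and remainders, so its least positive element generates
    it. *)
Lemma period_exists j :
  exists N, (0 < N)%N /\ forall n, P j n <-> (N %| n)%N.
Proof.
have ex : exists n, (0 < n)%N && `[< P j n >].
  have [s Ps] := Pcvg j; exists (m * p ^ s)%N.
  by rewrite muln_gt0 m_gt0 expn_gt0 prime_gt0 //=; apply/asboolP.
case: (ex_minnP ex) => N /andP[N_gt0 /asboolP PN] Nmin; exists N; split=> // n.
have Pmul k : P j (k * N)%N.
  by elim: k => [|k IHk]; rewrite ?mul0n // mulSn; apply/Padd.
split=> [Pn|/dvdnP[k ->] //].
apply: contraT => nN.
have Pmod : P j (n %% N)%N.
  by apply/(Padd (n %% N) (Pmul (n %/ N)%N)); rewrite -divn_eq.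
have := Nmin (n %% N)%N.
rewrite lt0n nN; have /asboolP -> := Pmod => /(_ isT).
by rewrite leqNgt ltn_mod N_gt0.
Qed.

(** The p'-parts of the periods form a divisibility chain of divisors of m, hence stabilise at some
    k, while [Psep] makes the p-parts unbounded. *)
Lemma scale_exists : exists2 k, (0 < k)%N & [/\ (k %| m)%N,
  forall s, exists j, forall n, P j n -> (k * p ^ s %| n)%N &
  forall j, exists s, P j (k * p ^ s)%N].
Proof.
have [N N_gt0 PN] : exists2 N : nat -> nat, forall j, (0 < N j)%N &
    forall j n, P j n <-> (N j %| n)%N.
  have /choice[N NP] := period_exists.
  by exists N => j; have [] := NP j.
pose M j := ((N j)`_p^')%N; pose e j := logn p (N j).
have NE j : N j = (M j * p ^ e j)%N.
  by rewrite -(partnC p (N_gt0 j)) p_part mulnC.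
have Mdvd i j : (i <= j)%N -> (M i %| M j)%N.
  move=> ij; apply: partn_dvd => //; apply/PN/(Pdecr ij).
  exact/PN.
have Mm j : (M j %| m)%N.
  have [s /PN Ns] := Pcvg j.
  have : (M j %| m * p ^ s)%N by apply: dvdn_trans Ns; exact: dvdn_part.
  rewrite Gauss_dvdl // coprime_sym coprimeXl // prime_coprime //.
  rewrite /M; apply/negP => pM.
  have := part_pnat (p^')%N (N j); rewrite /pnat => /andP[_ /allP/(_ p)].
  by rewrite mem_primes p_pr part_gt0 pM => /(_ isT); rewrite !inE eqxx.
pose Q i := `[< exists j, M j = i >].
have exQ : exists i, Q i by exists (M 0%N); apply/asboolP; exists 0%N.
have ubQ i : Q i -> (i <= m)%N by move=> /asboolP[j <-]; exact: dvdn_leq.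
case: (ex_maxnP exQ ubQ) => k /asboolP[j0 kE] kmax.
have Mk j : (j0 <= j)%N -> M j = k.
  move=> jj; apply/eqP; rewrite eqn_leq kmax /=; last first.
    by apply/asboolP; exists j.
  by rewrite -kE dvdn_leq ?part_gt0 ?Mdvd.
exists k; first by rewrite -kE part_gt0.
split=> [|s|j]; first by rewrite -kE.
(* As k p^s is no return time at level j, the period at level [maxn j0 j] must have p-exponent at
   least s. *)
- have [|j nPj] := @Psep (k * p ^ s)%N.
    by rewrite muln_gt0 -{1}kE part_gt0 expn_gt0 prime_gt0.
  exists (maxn j0 j) => n /PN; apply: dvdn_trans.
  rewrite NE Mk ?leq_maxl // dvdn_pmul2l ?dvdn_exp2l -?{1}kE ?part_gt0 //.
  rewrite leqNgt; apply/negP => es; apply: nPj.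
  apply: (Pdecr (leq_maxr j0 j)); apply/PN.
  by rewrite NE Mk ?leq_maxl // dvdn_mul // dvdn_exp2l // ltnW.
- exists (e j); apply/PN; rewrite NE dvdn_mul //.
  by rewrite -(Mk (maxn j0 j)) ?leq_maxl // Mdvd // leq_maxr.
Qed.
End Arithmetic.

(** * Odometers *)

Section OdometerTopology.
Variable q : odometer_scale.
Implicit Types x z : odometer q.

Lemma ocoord_nbhs z s : nbhs z [set x : odometer q | x s = z s].
Proof.
pose W : odometer q -> prod_topology (fun=> nat) := @ocoord q.
have ci : W @ nbhs z --> W z by exact: initial_continuous.
have cs : nbhs (W z) (@proj nat (fun=> nat) s @^-1` [set z s]).
  apply: proj_continuous; apply: open_nbhs_nbhs.
  by split=> //; exact: discrete_open.
exact: ci cs.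
Qed.

Lemma odometer_cvg (F : set_system (odometer q)) z : Filter F ->
  (forall s, F [set x : odometer q | x s = z s]) -> F --> z.
Proof.
move=> FF Fz A [_ [[W oW <-] Wz WA]]; apply: (filterS WA).
pose V : odometer q -> prod_topology (fun=> nat) := @ocoord q.
have : V @ F --> V z.
  apply/cvg_sup => i U [B] [[D] oD <-] Dz /filterS; apply.
  suff : F (V @^-1` (@^~ i @^-1` D)) by [].
  by apply: filterS (Fz i) => x /= xz; rewrite /preimage /= /V xz.
by apply; exact: open_nbhs_nbhs.
Qed.

Lemma odometer_hausdorff : hausdorff_space (odometer q).
Proof.
move=> x y xy; apply: odometerP => s.
have [z [/= <- <-]] := xy _ _ (ocoord_nbhs x s) (ocoord_nbhs y s).
by [].
Qed.

Lemma ocoord_modD x s i : (x (s + i) %% q s)%N = x s.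
Proof.
elim: i => [|i IHi]; first by rewrite addn0 ocoord_small.
rewrite addnS -[RHS]IHi -(ocoord_mod x (s + i)) modn_dvdm //.
elim: i {IHi} => [|i IHi]; first by rewrite addn0.
by rewrite addnS (dvdn_trans IHi) ?scale_dvd.
Qed.

Lemma odometer_compact : compact [set: odometer q].
Proof.
rewrite compact_ultra => F FU _.
(* If no value were selected, the ultrafilter would contain every set [n <= x s], even the empty one
   for [n = q s]. *)
have ex s : exists i, F [set x : odometer q | x s = i].
  apply: contrapT => /forallNP nF.
  suff : forall n, F [set x : odometer q | (n <= x s)%N].
    move=> /(_ (q s)) /filter_ex[x /=].
    by rewrite leqNgt ocoord_lt.
  elim=> [|n IHn]; first exact: filterE.
  have [/nF //|Fn] := in_ultra_setVsetC [set x : odometer q | x s = n] FU.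
  apply: filterS (filterI IHn Fn) => x [/= nx /eqP xn].
  by rewrite ltn_neqAle eq_sym xn.
have [f Ff] := choice ex.
(* Two members of F share a point, so the selected residues are compatible. *)
have fq s : (f s.+1 = f s %[mod q s])%N.
  have FF : ProperFilter F by exact: ultra_proper.
  have [x [<- <-]] := filter_ex (filterI (Ff s.+1) (Ff s)).
  by rewrite ocoord_mod ocoord_small.
exists (odometer_of fq); split=> //; apply: odometer_cvg => s.
by apply: filterS (Ff s) => x /= <-; rewrite ocoord_small.
Qed.

End OdometerTopology.

(** * From nested invariant equivalence relations to an odometer *)

Section ConjugateOdometer.
Variables (X : topologicalType) (f : X -> X) (R : nat -> X -> X -> Prop).
Variable q : odometer_scale.
Hypothesis Rsym : forall j x y, R j x y -> R j y x.
Hypothesis Rtrans : forall j x y z, R j x y -> R j y z -> R j x z.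
Hypothesis Rdecr : forall i j x y, (i <= j)%N -> R j x y -> R i x y.
Hypothesis Rf : forall j x y, R j x y -> R j (f x) (f y).
Hypothesis Rnbhs : forall j x, nbhs x [set y | R j x y].
Hypothesis Rsep : forall x y, (forall j, R j x y) -> x = y.
Hypothesis q_return :
  forall s, exists j, forall x n, R j x (iter n f x) -> (q s %| n)%N.
Hypothesis return_q : forall j, exists s, forall x, R j x (iter (q s) f x).

(** Level [j] is fine enough to determine coordinate [s]. *)
Let good s j := forall x n, R j x (iter n f x) -> (q s %| n)%N.

Let Rrefl j x : R j x x.
Proof. exact: nbhs_singleton (Rnbhs j x). Qed.

Let good_le s i j : (i <= j)%N -> good s i -> good s j.
Proof. by move=> ij si x n /(Rdecr ij)/si. Qed.

Let R_mod s i x a b : good s i -> R i (iter a f x) (iter b f x) ->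
  a = b %[mod q s].
Proof.
move=> si; wlog ab : a b / (a <= b)%N => [wl|] Rab.
  by have [/wl|/ltnW/wl <- //] := leqP a b; [exact|exact: Rsym].
move: Rab; rewrite -{1 2}(subnK ab) iterD => /si/dvdnP[k ->].
by rewrite modnMDl.
Qed.

(** Makes coordinate [s] of a point independent of the time and of the level that approximate it. *)
Let R_same s i j x y a b : good s i -> good s j ->
  R i (iter a f x) y -> R j (iter b f x) y -> a = b %[mod q s].
Proof.
wlog ij : i j a b / (i <= j)%N => [wl|] si sj Ra Rb.
  have [ij|/ltnW ji] := leqP i j; first exact: (wl i j).
  by apply/esym/(wl j i).
exact: R_mod si (Rtrans Ra (Rsym (Rdecr ij Rb))).
Qed.

Let return_mod s j x a b : (forall x, R j x (iter (q s) f x)) ->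
  a = b %[mod q s] -> R j (iter a f x) (iter b f x).
Proof.
move=> Rq; suff H n : R j (iter (n %% q s) f x) (iter n f x).
  by move=> ab; apply: Rtrans (H b); rewrite -ab; exact: Rsym.
rewrite {2}(divn_eq n (q s)); elim: (n %/ q s)%N => [|k IHk].
  by rewrite mul0n add0n.
by rewrite mulSn -addnA iterD; exact: Rtrans (Rq _).
Qed.

(** A point y of E is sent to the residues modulo [q s] of the times at which the orbit of [x0] is
    close to y. Compactness of E gives surjectivity and the continuity of the inverse. *)
Lemma conjugate_odometer E : minimal_subsystem f E ->
  topologically_conjugate E f [set: odometer q] (@adding_machine q).
Proof.
move=> [[[x0 Ex0] cE fE] Emin].
have Ef x : E x -> E (f x) by move=> Ex; apply: fE; exists x.
have Eiter n : E (iter n f x0) by elim: n => //= n; exact: Ef.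
have orb y j : E y -> exists n, R j (iter n f x0) y.
  rewrite (Emin _ Ex0) => /(_ _ (Rnbhs j y))[_ [[n _ <-] Rn]].
  by exists n; exact: Rsym.
have [js jsP] := choice q_return.
have jsS s : good s (js s.+1).
  by move=> x n /jsP; apply: dvdn_trans; exact: scale_dvd.
(* All good levels are covered at once, so that any of them may be used later; the value 0 outside E
   is a dummy. *)
have /choice[h hP] : forall y, exists z : odometer q, E y ->
    forall s j n, good s j -> R j (iter n f x0) y -> z s = (n %% q s)%N.
  move=> y; have [Ey|nEy] := pselect (E y); last by exists 0.
  have /choice[n nP] s : exists n, R (js s) (iter n f x0) y by exact: orb.
  have nq s : (n s.+1 = n s %[mod q s])%N.
    exact: R_same (jsS s) (jsP s) (nP _) (nP _).
  exists (odometer_of nq) => _ s j m sj Rm /=.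
  exact: R_same (jsP s) sj (nP _) Rm.
have hN n s : h (iter n f x0) s = (n %% q s)%N.
  exact: (hP _ (Eiter n) s (js s) n (jsP s) (Rrefl _ _)).
have hf x : E x -> h (f x) = adding_machine (h x).
  move=> Ex; apply: odometerP => s.
  have [n Rn] := orb _ (js s) Ex.
  rewrite (hP _ (Ef _ Ex) s (js s) n.+1 (jsP s)); last exact: Rf.
  by rewrite /= (hP _ Ex _ _ _ (jsP s) Rn) modnDm addn1.
have hc : {within E, continuous h}.
  apply/subspace_continuousP => x Ex; apply: odometer_cvg => s.
  have [n Rn] := orb _ (js s) Ex.
  apply: filterS (Rnbhs (js s) x) => y /= Rxy Ey.
  by rewrite (hP _ Ex _ _ _ (jsP s) Rn) (hP _ Ey _ _ _ (jsP s) (Rtrans Rn Rxy)).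
(* Times congruent modulo [q s] give j-close points of the orbit, for a suitable s at each level
   j. *)
have hinj x y : E x -> E y -> h x = h y -> x = y.
  move=> Ex Ey hxy; apply: Rsep => j; have [s Rs] := return_q j.
  pose i := maxn j (js s).
  have si : good s i by apply: good_le (jsP s); exact: leq_maxr.
  have [a Ra] := orb _ i Ex; have [b Rb] := orb _ i Ey.
  have ab : a = b %[mod q s].
    by rewrite -(hP _ Ex _ _ _ si Ra) -(hP _ Ey _ _ _ si Rb) hxy.
  have ji : (j <= i)%N by exact: leq_maxl.
  apply: Rtrans (Rdecr ji Rb).
  exact: Rtrans (Rsym (Rdecr ji Ra)) (return_mod _ Rs ab).
have him C : C `<=` E -> compact C -> closed (h @` C).
  move=> CE cC; apply: compact_closed; first exact: odometer_hausdorff.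
  by apply: continuous_compact => //; exact: continuous_subspaceW hc.
have hsurj z : exists x, E x /\ h x = z.
  suff [x Ex xz] : (h @` E) z by exists x.
  (* The n-th term agrees with z in all coordinates s <= n, so z is a limit of points of the closed
     image. *)
  pose u (n : nat) : odometer q := h (iter (z n) f x0).
  have uz : u @ \oo --> z.
    apply: odometer_cvg => s; exists s => // n /= sn.
    by rewrite /u hN -(subnKC sn) ocoord_modD.
  apply: (@closed_cvg _ _ _ _ u _ _ _ _ uz); first exact: him.
  by apply: nearW => n; exists (iter (z n) f x0).
have [h' h'P] := choice hsurj.
exists h, h'; split=> //.
- by split=> [x _ //|z _]; have [] := h'P z.
- split=> //; apply: continuous_subspaceT => z U.
  rewrite nbhsE => -[V [oV Vz] VU].
  (* The complement of this closed image is a neighbourhood of z, by injectivity, and [h'] maps it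
     into V. *)
  have cC : closed (h @` (E `&` ~` V)).
    apply: him => [x []//|]; apply: compact_closedI => //.
    exact: open_closedC.
  have nz : (~` (h @` (E `&` ~` V))) z.
    move=> [x [Ex nVx] hx]; apply: nVx.
    by have [Ez hz] := h'P z; rewrite (hinj x (h' z)) // hz.
  have : nbhs z (~` (h @` (E `&` ~` V))).
    by apply: open_nbhs_nbhs; split => //; exact: closed_openC.
  apply: filterS => y ny; apply: VU; apply: contrapT => nV; apply: ny.
  by have [Ey hy] := h'P y; exists (h' y).
- split=> [x Ex|y _]; last by have [] := h'P y.
  by have [Eh hh] := h'P (h x); apply: hinj.
Qed.

End ConjugateOdometer.

(** * The ring of p-adic integers *)

Section PadicIntegers.
Variables (p : nat) (p_pr : prime p).
Local Notation Zp := (padic_int p_pr).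
Implicit Types x y z e t : Zp.

Lemma padic_coord_natr n s : (n%:R : Zp) s = (n %% p ^ s)%N.
Proof.
elim: n => [|n IHn]; first by rewrite mod0n /= mod0n.
by rewrite -[n.+1]addn1 natrD /= IHn modnDm.
Qed.

(** Coordinate n of the quotient is coordinate s + n of x divided by p^s. *)
Lemma padic_dvdP x s : x s = 0%N <-> exists y, x = p%:R ^+ s * y.
Proof.
split=> [xs0|[y ->]]; last first.
  by rewrite -natrX /= padic_coord_natr modnn mul0n mod0n.
have dvdx n : (p ^ s * (x (s + n) %/ p ^ s))%N = x (s + n)%N.
  by rewrite mulnC divnK // /dvdn padic_int_mod xs0.
have yP n : (x (s + n.+1) %/ p ^ s = x (s + n) %/ p ^ s %[mod p ^ n])%N.
  rewrite !modn_divl -expnD [(n + s)%N]addnC addnS.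
  by rewrite (ocoord_mod x (s + n)) (ocoord_small x (s + n)).
exists (@odometer_of (ppow_scale p_pr) _ yP); apply: odometerP => n.
rewrite -natrX /= padic_coord_natr modnMm dvdx addnC padic_int_mod //.
Qed.

Lemma padic_int_eq0 x : (forall s, exists y, x = p%:R ^+ s * y) -> x = 0.
Proof.
by move=> H; apply: odometerP => s; rewrite /= mod0n; apply/padic_dvdP.
Qed.

Definition padic_red x : 'F_p := (x 1%N)%:R.

Fact padic_red_nmod_morphism : nmod_morphism padic_red.
Proof.
by split=> [|x y]; rewrite /padic_red /= ?expn1 Fp_nat_mod // ?natrD.
Qed.
HB.instance Definition _ :=
  GRing.isNmodMorphism.Build Zp 'F_p padic_red padic_red_nmod_morphism.

Fact padic_red_monoid_morphism : monoid_morphism padic_red.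
Proof.
by split=> [|x y]; rewrite /padic_red /= ?expn1 Fp_nat_mod // ?natrM.
Qed.
HB.instance Definition _ :=
  GRing.isMonoidMorphism.Build Zp 'F_p padic_red padic_red_monoid_morphism.

Lemma padic_red_eq0P x : padic_red x = 0 <-> exists y, x = p%:R * y.
Proof.
have -> : padic_red x = 0 <-> x 1%N = 0%N.
  rewrite /padic_red; split=> [/(congr1 val)/=|-> //].
  by rewrite val_Fp_nat // -[X in (_ %% X)%N]expn1 (ocoord_small x 1).
by rewrite padic_dvdP expr1.
Qed.

Lemma padic_p_neq0 : p%:R != 0 :> Zp.
Proof.
apply/eqP => /(congr1 (fun x : Zp => x 2)) /=.
rewrite padic_coord_natr mod0n modn_small.
  by have := prime_gt0 p_pr; case: (p).
by rewrite -{1}[p]expn1 ltn_exp2l // prime_gt1.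
Qed.

(** Banach's fixed point theorem with divisibility by p as contraction; the limit of the iterates of
    0 is read off their diagonal coordinates. *)
Lemma padic_contraction (g : Zp -> Zp) :
  (forall x y, exists z, g x - g y = p%:R * (x - y) * z) -> exists x, g x = x.
Proof.
move=> gP; pose w n := iter n g 0.
have wS n : exists z, w n.+1 - w n = p%:R ^+ n * z.
  elim: n => [|n [z IHn]]; first by exists (w 1%N - w 0%N); rewrite expr0 mul1r.
  have [z' zE] := gP (w n.+1) (w n); exists (z * z').
  by rewrite [LHS]zE IHn exprS; ring.
have wq n : (w n.+1 n.+1 = w n n %[mod p ^ n])%N.
  rewrite (ocoord_mod (w n.+1)) (ocoord_small (w n)).
  have [z /eqP] := wS n; rewrite subr_eq => /eqP -> /=.
  by rewrite -natrX padic_coord_natr modnn mul0n mod0n add0n ocoord_small.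
pose x : Zp := @odometer_of (ppow_scale p_pr) _ wq.
have xw n : exists z, x - w n = p%:R ^+ n * z.
  apply/padic_dvdP => /=; rewrite ocoord_small modnDmr.
  by rewrite subnKC ?modnn // ltnW // (ocoord_lt (w n)).
exists x; apply: subr0_eq; apply/padic_int_eq0 => n.
have [z1 e1] := gP x (w n); have [z2 e2] := wS n; have [z3 e3] := xw n.
exists (p%:R * z3 * z1 + z2 - z3).
have -> : g x - x = (g x - g (w n)) + (w n.+1 - w n) - (x - w n).
  by rewrite [w n.+1]/=; ring.
by rewrite e1 e2 e3; ring.
Qed.

(** For a lift a of the inverse residue, the geometric series in [1 - x * a] arises as a fixed point
    and inverts [x * a]. *)
Lemma padic_unit x : padic_red x != 0 -> exists y, x * y = 1.
Proof.
move=> x0; pose a : Zp := (nat_of_ord (padic_red x)^-1)%:R.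
have [e eE] : exists e, 1 - x * a = p%:R * e.
  apply/padic_red_eq0P; rewrite rmorphB rmorphM rmorph1 rmorph_nat.
  by rewrite natr_Zp mulfV // subrr.
have [y yE] : exists y, 1 + (1 - x * a) * y = y.
  by apply: padic_contraction => y z; exists e; rewrite eE; ring.
exists (a * y); apply: (addIr (y - x * a * y)).
by transitivity y; [ring|rewrite -[LHS]yE; ring].
Qed.

Lemma padic_hensel e : padic_red e = 0 ->
  exists2 w, padic_red w = 0 & w ^+ 2 + w + e = 0.
Proof.
move=> /padic_red_eq0P[e' ->].
(* Substituting w = p v and dividing by p turns the equation into this contraction. *)
have [v vE] : exists v, - e' - p%:R * v ^+ 2 = v.
  by apply: padic_contraction => y z; exists (- (y + z)); ring.
exists (p%:R * v); first by apply/padic_red_eq0P; exists v.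
by rewrite -{2}vE; ring.
Qed.

Lemma padic_simple_root t (a : 'F_p) :
  a ^+ 2 - padic_red t * a + 1 = 0 -> a ^+ 2 != 1 ->
  exists2 r, padic_red r = a & r ^+ 2 - t * r + 1 = 0.
Proof.
move=> a_root a2; have [x xa] : exists x : Zp, padic_red x = a.
  by exists (nat_of_ord a)%:R; rewrite rmorph_nat natr_Zp.
(* The roots a and 1/a differ because a^2 is not 1, so the derivative at x is a unit. *)
have : padic_red (2 * x - t) != 0.
  rewrite rmorphB rmorphM rmorph_nat /= xa; apply: contra a2 => /eqP d0.
  rewrite -subr_eq0; apply/eqP.
  transitivity (a * (2 * a - padic_red t) - (a ^+ 2 - padic_red t * a + 1)).
    by ring.
  by rewrite d0 a_root mulr0 subr0.
case/padic_unit=> y yE.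
have [|w w0 wE] := @padic_hensel ((x ^+ 2 - t * x + 1) * y ^+ 2).
  rewrite rmorphM rmorphD rmorphB (rmorphXn _ 2 x) (rmorphM _ t x).
  by rewrite rmorph1 /= xa a_root mul0r.
(* Scaling the correction by the derivative brings the quadratic to the form w^2 + w + e. *)
exists (x + (2 * x - t) * w).
  by rewrite rmorphD rmorphM /= w0 mulr0 addr0.
transitivity ((2 * x - t) ^+ 2 * (w ^+ 2 + w + (x ^+ 2 - t * x + 1) * y ^+ 2)).
  transitivity ((2 * x - t) ^+ 2 * (w ^+ 2 + w) +
      (x ^+ 2 - t * x + 1) * ((2 * x - t) * y) ^+ 2); last by ring.
  by rewrite yE; ring.
by rewrite wE mulr0.
Qed.

Lemma padic_int_decomp x : x != 0 ->
  exists k y, x = p%:R ^+ k * y /\ padic_red y != 0.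
Proof.
move=> x0; have ex : exists m, x m != 0%N.
  apply: contrapT => /forallNP xs; move/eqP: x0; apply.
  by apply: odometerP => s; rewrite /= mod0n; have /negP/negPn/eqP := xs s.
(* The valuation precedes the least index of a nonzero coordinate; index 0 is excluded, being modulo
   1. *)
case: (ex_minnP ex) => -[|k] xk kmin.
  by have := ocoord_lt x 0; rewrite /= expn0 ltnS leqn0 (negbTE xk).
have /padic_dvdP[y yE] : x k = 0%N.
  by apply/eqP; apply: contraT => /kmin; rewrite ltnn.
exists k, y; split=> //; apply: contra xk => /eqP/padic_red_eq0P[z zE].
by apply/eqP/padic_dvdP; exists z; rewrite yE zE exprSr mulrA.
Qed.

Lemma padic_coord_eq x y s : x s = y s -> exists z, x = y + p%:R ^+ s * z.
Proof.
move=> xy; have /padic_dvdP[z zE] : (x - y) s = 0%N.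
  by rewrite /= modnDmr xy subnKC ?modnn // ltnW // (ocoord_lt y).
by exists z; rewrite -zE addrC subrK.
Qed.

End PadicIntegers.

(** * The field of p-adic numbers *)

Lemma fractionP (R : idomainType) (x : {fraction R}) :
  exists a b : R, b != 0 /\ x * tofrac b = tofrac a.
Proof.
elim/quotW: x => r; exists \n_r, \d_r; split; first exact: denom_ratioP.
unlock tofrac; rewrite -[LHS]FracField.pi_mul; apply/eqmodP.
rewrite /= FracField.equivfE /FracField.mulf.
by rewrite !numden_Ratio ?mulf_neq0 ?denom_ratioP ?oner_neq0 // !mulr1 mulrC.
Qed.

Section PadicField.
Variables (p : nat) (p_pr : prime p).
Local Notation Zp := (padic_int p_pr).
(* Any fraction field of Z_p: unification diverges in the concrete quotient. *)
Variables (Qp : fieldType) (iota : {rmorphism Zp -> Qp}).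
Hypothesis iota_inj : injective iota.
Hypothesis iota_frac :
  forall x : Qp, exists a b : Zp, b != 0 /\ x * iota b = iota a.
Implicit Types x y : Qp.
Local Notation pi := (p%:R : Qp).

Let padic_of_int_eq0 (z : Zp) : (iota z == 0) = (z == 0).
Proof. by rewrite -(inj_eq iota_inj) rmorph0. Qed.

Lemma padic_pi_neq0 : pi != 0.
Proof. by rewrite -(rmorph_nat iota) padic_of_int_eq0 padic_p_neq0. Qed.

Lemma padic_pi_exp_neq0 n : pi ^+ n != 0.
Proof. by rewrite expf_neq0 ?padic_pi_neq0. Qed.

(** The ball |x| <= p^-j; these balls stand in for an absolute value. *)
Definition padic_in (j : nat) : set Qp :=
  [set x | exists z : Zp, x = pi ^+ j * iota z].

Lemma padic_in0 j : padic_in j 0.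
Proof. by exists 0; rewrite rmorph0 mulr0. Qed.

Lemma padic_inD j x y : padic_in j x -> padic_in j y -> padic_in j (x + y).
Proof. by move=> [z ->] [t ->]; exists (z + t); rewrite rmorphD mulrDr. Qed.

Lemma padic_inN j x : padic_in j x -> padic_in j (- x).
Proof. by move=> [z ->]; exists (- z); rewrite rmorphN mulrN. Qed.

Lemma padic_inM i j x y :
  padic_in i x -> padic_in j y -> padic_in (i + j) (x * y).
Proof.
by move=> [z ->] [t ->]; exists (z * t); rewrite rmorphM exprD mulrACA.
Qed.

Lemma padic_in_le i j x : (i <= j)%N -> padic_in j x -> padic_in i x.
Proof.
move=> /subnKC <- [z ->]; exists (p%:R ^+ (j - i) * z).
by rewrite rmorphM rmorphXn rmorph_nat exprD mulrA.
Qed.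

Lemma padic_in_of_int z : padic_in 0 (iota z).
Proof. by exists z; rewrite expr0 mul1r. Qed.

Lemma padic_in_pi n : padic_in n (pi ^+ n).
Proof. by exists 1; rewrite rmorph1 mulr1. Qed.

Lemma padic_in_piM m n x : padic_in (m + n) (pi ^+ m * x) -> padic_in n x.
Proof.
move=> [z]; rewrite exprD -mulrA => /(mulfI (padic_pi_exp_neq0 m)) ->.
by exists z.
Qed.

Lemma padic_in1_1 : ~ padic_in 1 1.
Proof.
move=> [z]; rewrite expr1 -(rmorph_nat iota) -rmorphM -(rmorph1 iota).
move=> /iota_inj z1.
have : padic_red (1 : Zp) = 0 by apply/padic_red_eq0P; exists z.
by rewrite rmorph1 => /eqP; rewrite oner_eq0.
Qed.

(** Separating |x| <= 1 from |x| > 1 keeps exponents natural; v is the inverse of the unit u. *)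
Lemma padic_unit_form x : x != 0 -> exists n u v,
  iota u * iota v = 1 /\ (x = pi ^+ n * iota u \/ x^-1 = pi ^+ n.+1 * iota u).
Proof.
move=> x0; have [a [b [b0 xba]]] := iota_frac x.
have a0 : a != 0.
  by rewrite -padic_of_int_eq0 -xba mulf_neq0 // padic_of_int_eq0.
have [k [u [aE /padic_unit[u' uu']]]] := padic_int_decomp a0.
have [l [v [bE /padic_unit[v' vv']]]] := padic_int_decomp b0.
have {}uu' : iota u * iota u' = 1 by rewrite -rmorphM uu' rmorph1.
have {}vv' : iota v * iota v' = 1 by rewrite -rmorphM vv' rmorph1.
have xE : x * pi ^+ l = pi ^+ k * (iota u * iota v').
  move: xba; rewrite aE bE !rmorphM !rmorphXn !rmorph_nat => xba.
  have -> : x * pi ^+ l = x * (pi ^+ l * iota v) * iota v'.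
    by rewrite -mulrA -(mulrA _ (iota v)) vv' mulr1.
  by rewrite xba mulrA.
have [lk|kl] := leqP l k.
  exists (k - l)%N, (u * v'), (u' * v); rewrite !rmorphM; split.
    by transitivity ((iota u * iota u') * (iota v * iota v'));
      [ring|rewrite uu' vv' mulr1].
  left; apply: (mulIf (padic_pi_exp_neq0 l)).
  by rewrite xE -{1}(subnK lk) exprD; ring.
exists (l - k).-1, (v * u'), (v' * u); rewrite !rmorphM; split.
  by transitivity ((iota u * iota u') * (iota v * iota v'));
    [ring|rewrite uu' vv' mulr1].
right; apply: (mulfI x0); rewrite mulfV // prednK ?subn_gt0 //.
apply: (mulIf (padic_pi_exp_neq0 k)).
have -> : x * (pi ^+ (l - k) * (iota v * iota u')) * pi ^+ k =
    x * pi ^+ l * (iota v * iota u').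
  by rewrite -[in RHS](subnK (ltnW kl)) exprD; ring.
rewrite xE mul1r.
transitivity (pi ^+ k * ((iota u * iota u') * (iota v * iota v'))).
  by rewrite uu' vv' !mulr1.
by ring.
Qed.

Lemma padic_in_or_inv x : padic_in 0 x \/ (x != 0 /\ padic_in 1 x^-1).
Proof.
have [->|x0] := eqVneq x 0; first by left; exact: padic_in0.
have [n [u [v [_ [->|xE]]]]] := padic_unit_form x0; [left|right].
  by apply: (@padic_in_le _ n) => //; exists u.
by split=> //; apply: (@padic_in_le _ n.+1) => //; exists u.
Qed.

(** Here p^m clears the denominator of x. *)
Lemma padic_small x :
  exists m, forall n y, padic_in (m + n) y -> padic_in n (y * x).
Proof.
suff [m xm] : exists m, padic_in 0 (pi ^+ m * x).
  exists m => n _ [z ->].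
  have := padic_inM xm (ex_intro _ z erefl : padic_in n (pi ^+ n * iota z)).
  by rewrite exprD add0n; congr padic_in; ring.
have [->|x0] := eqVneq x 0.
  by exists 0%N; rewrite mulr0; exact: padic_in0.
have [n [u [v [uv [->|xE]]]]] := padic_unit_form x0.
  by exists 0%N; rewrite mul1r; apply: (@padic_in_le _ n) => //; exists u.
have xP : x * (pi ^+ n.+1 * iota u) = 1 by rewrite -xE mulfV.
exists n.+1; exists v; rewrite expr0 mul1r.
transitivity (x * (pi ^+ n.+1 * iota u) * iota v); last by rewrite xP mul1r.
transitivity (pi ^+ n.+1 * x * (iota u * iota v)); last by ring.
by rewrite uv mulr1.
Qed.

Lemma padic_in_sep x : (forall j, padic_in j x) -> x = 0.
Proof.
move=> xj; apply/eqP; apply: contraT => x0; have [m mP] := padic_small x^-1.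
by have := mP 1%N x (xj _); rewrite mulfV // => /padic_in1_1.
Qed.

Lemma padic_in_sqr j x : padic_in (j + j) (x ^+ 2) -> padic_in j x.
Proof.
move=> xj; set y := x / pi ^+ j; have xE : x = pi ^+ j * y.
  by rewrite mulrC divfK // padic_pi_exp_neq0.
have : padic_in 0 (y ^+ 2).
  by apply: (@padic_in_piM (j + j)); rewrite addn0 exprD -expr2 -exprMn -xE.
case: (padic_in_or_inv y) => [y0 _|[y0 y1] y2].
  by have := padic_inM (padic_in_pi j) y0; rewrite addn0 -xE.
case: padic_in1_1; apply: (@padic_in_le _ (0 + (1 + 1))) => //.
have := padic_inM y2 (padic_inM y1 y1).
by rewrite -expr2 -exprMn mulfV // expr1n.
Qed.

(** Were 1/(1 + h/x) not integral, 1 + h/x and hence 1 would lie in p Z_p. *)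
Lemma padic_in_perturb x h : x != 0 -> padic_in 1 (h / x) ->
  padic_in 0 (x / (x + h)).
Proof.
move=> x0 hx; have -> : x / (x + h) = (1 + h / x)^-1.
  have -> : x + h = x * (1 + h / x) by rewrite mulrDr mulr1 mulrCA mulfV ?mulr1.
  by rewrite invfM mulrA mulfV ?mul1r.
case: (padic_in_or_inv (1 + h / x)^-1) => // -[_]; rewrite invrK => hx1.
by case: padic_in1_1; rewrite -[1](addrK (h / x));
  exact: padic_inD (padic_inN _).
Qed.

Lemma padic_quadratic_root e : padic_in 1 e -> exists w, w ^+ 2 + w + e = 0.
Proof.
move=> [z eE]; have [|w _ wE] := @padic_hensel p p_pr (p%:R * z).
  by apply/padic_red_eq0P; exists z.
exists (iota w); rewrite eE expr1 -(rmorph_nat iota) -rmorphM -rmorphXn.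
by rewrite -!rmorphD wE rmorph0.
Qed.

(* If |a c| < |b|^2, Hensel's lemma provides a root. *)
Lemma padic_anisotropic a b c : a != 0 -> c != 0 ->
  (forall x, a * x ^+ 2 + b * x + c != 0) -> padic_in 0 (b ^+ 2 / (a * c)).
Proof.
move=> a0 c0 nr; case: (padic_in_or_inv (b ^+ 2 / (a * c))) => //.
move=> [b0 /padic_quadratic_root[w wE]].
have {}b0 : b != 0 by apply: contraNneq b0 => ->; rewrite expr0n mul0r.
(* At this point the quadratic equals b^2/a times w^2 + w + ac/b^2. *)
have /eqP[] := nr (w * b / a).
transitivity (b ^+ 2 / a * (w ^+ 2 + w + (b ^+ 2 / (a * c))^-1)).
  by field; rewrite a0 b0 c0.
by rewrite wE mulr0.
Qed.

Lemma padic_natr_neq0 n : (0 < n)%N -> n%:R != 0 :> Qp.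
Proof.
move=> n0; rewrite -(rmorph_nat iota) padic_of_int_eq0; apply/eqP.
move=> /(congr1 (fun z : Zp => z n)); rewrite padic_coord_natr /= mod0n.
rewrite modn_small; last by rewrite ltn_expl ?prime_gt1.
by move=> n_eq0; move: n0; rewrite n_eq0.
Qed.

End PadicField.

(** * The fixed point form of a homography *)

Section FixedPointForm.
Variables (F : fieldType) (a b c d : F).
Implicit Types v w z : F * F.

Local Notation D := (a * d - b * c).
Local Notation T := (a + d).

Definition mact v : F * F := (a * v.1 + b * v.2, c * v.1 + d * v.2).
Definition pdet v w := v.1 * w.2 - v.2 * w.1.
Definition pscale k v : F * F := (k * v.1, k * v.2).

(* This is pdet v (mact v), so its zeros are the fixed points. *)
Definition fixform v := c * v.1 ^+ 2 + (d - a) * v.1 * v.2 - b * v.2 ^+ 2.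
(** The polar form Q(v + w) - Q(v) - Q(w). *)
Definition fixpolar v w :=
  2 * c * v.1 * w.1 + (d - a) * (v.1 * w.2 + v.2 * w.1) - 2 * b * v.2 * w.2.
Definition pdist v w := pdet v w ^+ 2 / (fixform v * fixform w).

Lemma pdet_mact v : pdet v (mact v) = fixform v.
Proof. by rewrite /pdet /fixform /mact /=; ring. Qed.

Lemma fixform_scale k v : fixform (pscale k v) = k ^+ 2 * fixform v.
Proof. by rewrite /fixform /pscale /=; ring. Qed.

Lemma pdist_scale k l v w : k != 0 -> l != 0 ->
  pdist (pscale k v) (pscale l w) = pdist v w.
Proof.
move=> k0 l0; rewrite /pdist !fixform_scale.
have -> : pdet (pscale k v) (pscale l w) = k * l * pdet v w.
  by rewrite /pdet /pscale /=; ring.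
have -> : k ^+ 2 * fixform v * (l ^+ 2 * fixform w) =
    (k * l) ^+ 2 * (fixform v * fixform w) by ring.
by rewrite exprMn -mulf_div divff ?mul1r // expf_neq0 // mulf_neq0.
Qed.

Lemma pdist_mact v w : D != 0 -> pdist (mact v) (mact w) = pdist v w.
Proof.
move=> D0; rewrite /pdist.
have E z : fixform (mact z) = D * fixform z.
  by rewrite /fixform /mact /=; ring.
have -> : pdet (mact v) (mact w) = D * pdet v w.
  by rewrite /pdet /mact /=; ring.
have -> : fixform (mact v) * fixform (mact w) =
    D ^+ 2 * (fixform v * fixform w) by rewrite !E; ring.
by rewrite exprMn -mulf_div divff ?mul1r // expf_neq0.
Qed.

Lemma fixform_add k v w :
  fixform (k * v.1 + w.1, k * v.2 + w.2) =
  fixform v * k ^+ 2 + fixpolar v w * k + fixform w.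
Proof. by rewrite /fixform /fixpolar /=; ring. Qed.

(** Apply Q to the linear relation det(v,w) z + det(w,z) v + det(z,v) w = 0. *)
Lemma fixform_triple v w z : pdet z v ^+ 2 * fixform w =
  pdet v w ^+ 2 * fixform z + pdet w z ^+ 2 * fixform v +
  pdet v w * pdet w z * fixpolar v z.
Proof. by rewrite /fixform /fixpolar /pdet; ring. Qed.

(** The cross term is described by its square, which is what a bound on the polar form controls. *)
Lemma pdist_triple v w z :
  fixform v != 0 -> fixform w != 0 -> fixform z != 0 ->
  exists2 x, pdist v z = pdist v w + pdist w z + x &
    x ^+ 2 = pdist v w * pdist w z *
      (fixpolar v z ^+ 2 / (fixform v * fixform z)).
Proof.
move=> v0 w0 z0.
exists (pdet v w * pdet w z * fixpolar v z /
    (fixform v * fixform w * fixform z)).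
  apply: (mulIf (mulf_neq0 (mulf_neq0 v0 w0) z0)).
  transitivity (pdet z v ^+ 2 * fixform w).
    by rewrite /pdist /pdet; field; rewrite v0 z0.
  by rewrite fixform_triple /pdist; field; rewrite v0 w0 z0.
by rewrite /pdist; field; rewrite v0 w0 z0.
Qed.

(* lucas n = (u, w) with M ^ n = u M + w for the matrix M of the homography. *)
Fixpoint lucas n : F * F :=
  if n is n'.+1 then (T * (lucas n').1 + (lucas n').2, - (D * (lucas n').1))
  else (0, 1).

Definition lucas_vec n v : F * F :=
  ((lucas n).1 * (mact v).1 + (lucas n).2 * v.1,
   (lucas n).1 * (mact v).2 + (lucas n).2 * v.2).

Lemma lucas_vecS n v : lucas_vec n.+1 v = mact (lucas_vec n v).
Proof. by rewrite /lucas_vec /mact /=; congr pair; ring. Qed.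

(** Both sides are the determinant of M^n = u M + w. *)
Lemma lucas_norm n :
  (lucas n).2 ^+ 2 + T * (lucas n).1 * (lucas n).2 + D * (lucas n).1 ^+ 2 =
  D ^+ n.
Proof.
elim: n => [|n IHn] /=; first by ring.
by rewrite [in RHS]exprS -IHn; ring.
Qed.

Lemma fixform_lucas n v : fixform (lucas_vec n v) = D ^+ n * fixform v.
Proof. by rewrite -lucas_norm /lucas_vec /fixform /mact /=; ring. Qed.

Lemma pdist_lucas n v : D != 0 -> fixform v != 0 ->
  pdist v (lucas_vec n v) = (lucas n).1 ^+ 2 / D ^+ n.
Proof.
move=> /(expf_neq0 n) Dn0 v0; rewrite /pdist fixform_lucas.
have -> : pdet v (lucas_vec n v) = (lucas n).1 * fixform v.
  by rewrite -pdet_mact /pdet /lucas_vec /=; ring.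
by move: Dn0; set E := D ^+ n => E0; field; rewrite v0 E0.
Qed.

(** With eigenvalues x, y of M and l = x/y, both sides equal (x^n - y^n)^2; the induction avoids
    adjoining them. *)
Lemma lucas_cheb n : D != 0 ->
  D ^+ n * (cheb (T ^+ 2 / D - 2) n - 2) = (T ^+ 2 - 4 * D) * (lucas n).1 ^+ 2.
Proof.
move=> D0; set t := T ^+ 2 / D - 2.
have tD : D * t = T ^+ 2 - 2 * D by rewrite /t; field.
suff [] : D ^+ n * (cheb t n - 2) = (T ^+ 2 - 4 * D) * (lucas n).1 ^+ 2 /\
  D ^+ n.+1 * (cheb t n.+1 - 2) = (T ^+ 2 - 4 * D) * (lucas n.+1).1 ^+ 2 by [].
elim: n => [|n [IH0 IH1]]; split=> //.
- by rewrite /cheb /=; ring.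
- rewrite /cheb expr1 mulrBr tD /=; ring.
- rewrite chebSS.
  transitivity (D * t * (D ^+ n.+1 * (cheb t n.+1 - 2)) +
    2 * D ^+ n.+1 * (D * t) - D ^+ 2 * (D ^+ n * (cheb t n - 2)) -
    4 * D * D ^+ n.+1).
    by rewrite !(exprS _ n) (exprS _ n.+1) (exprS _ n); ring.
  rewrite IH0 IH1 tD (exprS _ n) -lucas_norm /=; ring.
Qed.

End FixedPointForm.

(** * Homographies without fixed points *)

Section ProjectiveLine.
Variables (F : fieldType) (a b c d : F).
Implicit Types x y : option F.

(** A copy of [homography] over any field, free of the topology on the projective line. *)
Definition moebius x : option F :=
  if x is Some t then
    if c * t + d == 0 then None else Some ((a * t + b) / (c * t + d))
  else if c == 0 then None else Some (a / c).

Definition prep x : F * F := if x is Some t then (t, 1) else (1, 0).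

Hypothesis det_neq0 : a * d - b * c != 0.
Hypothesis no_fixed_point : forall x, moebius x <> x.

Local Notation D := (a * d - b * c).
Local Notation T := (a + d).
Local Notation fixform := (fixform a b c d).
Local Notation mact := (mact a b c d).
Local Notation lucas := (lucas a b c d).

Definition moebius_dist x y := pdist a b c d (prep x) (prep y).

Lemma prep_inj x y : pdet (prep x) (prep y) = 0 -> x = y.
Proof.
case: x y => [t|] [s|] //=; rewrite /pdet /=.
- by rewrite mulr1 mul1r => /subr0_eq ->.
- by rewrite mulr0 mulr1 sub0r => /eqP; rewrite oppr_eq0 oner_eq0.
- by rewrite mulr1 mul0r subr0 => /eqP; rewrite oner_eq0.
Qed.

Lemma moebius_c_neq0 : c != 0.
Proof.
by apply/eqP => c0; have := no_fixed_point (x := None); rewrite /= c0 eqxx.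
Qed.

Lemma prep_moebius x :
  exists2 k, k != 0 & mact (prep x) = pscale k (prep (moebius x)).
Proof.
case: x => [t|] /=; last first.
  rewrite (negbTE moebius_c_neq0); exists c; first exact: moebius_c_neq0.
  rewrite /mact /pscale /=; congr pair; last by ring.
  by field; exact: moebius_c_neq0.
case: eqP => [ctd|/eqP ctd].
  exists (a * t + b).
    apply: contra det_neq0 => /eqP atb; apply/eqP.
    have [c0|c0] := eqVneq c 0; first by move: moebius_c_neq0; rewrite c0 eqxx.
    apply: (mulfI c0); rewrite mulr0.
    transitivity (c * (a * (c * t + d) - c * (a * t + b))); first by ring.
    by rewrite ctd atb !mulr0 subr0 mulr0.
  by rewrite /mact /pscale /=; congr pair; rewrite ?mulr1 // mulr0.
exists (c * t + d) => //; rewrite /mact /pscale /=; congr pair; last by ring.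
by field.
Qed.

Lemma fixform_prep x : fixform (prep x) != 0.
Proof.
apply/eqP => fx; apply: (@no_fixed_point x); apply/esym/prep_inj.
have [k k0 kE] := prep_moebius x; apply: (mulfI k0); rewrite mulr0 -fx.
by rewrite -pdet_mact kE /pdet /pscale /=; ring.
Qed.

Lemma fixform_eq0 v : fixform v = 0 -> v = (0, 0).
Proof.
have nz k x : k != 0 -> fixform (pscale k (prep x)) <> 0.
  move=> k0; rewrite fixform_scale => /eqP.
  by rewrite mulf_eq0 expf_eq0 (negbTE k0) (negbTE (fixform_prep x)).
case: v => s t; have [->|t0] := eqVneq t 0.
  have [-> //|s0] := eqVneq s 0.
  have -> : (s, 0) = pscale s (prep None) by rewrite /pscale /= mulr1 mulr0.
  by move/(nz _ _ s0).
have -> : (s, t) = pscale t (prep (Some (s / t))).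
  by rewrite /pscale /= mulr1 mulrC divfK.
by move/(nz _ _ t0).
Qed.

(** An eigenvalue x has the eigenvector (x - d, c), on which Q would vanish. *)
Lemma moebius_charpoly (x : F) : x ^+ 2 - T * x + D != 0.
Proof.
apply/eqP => xr; have : fixform (x - d, c) = 0.
  transitivity (c * (x ^+ 2 - T * x + D)); last by rewrite xr mulr0.
  by rewrite /fixform /=; ring.
by move=> /fixform_eq0[_ c0]; move: moebius_c_neq0; rewrite c0 eqxx.
Qed.

Lemma moebius_dist_eq0 x y : moebius_dist x y = 0 -> x = y.
Proof.
move=> /eqP; rewrite /moebius_dist /pdist mulf_eq0 invr_eq0 expf_eq0 /=.
by rewrite mulf_eq0 !(negbTE (fixform_prep _)) !orbF => /eqP/prep_inj.
Qed.

Lemma moebius_dist_sym x y : moebius_dist x y = moebius_dist y x.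
Proof.
rewrite /moebius_dist /pdist [fixform _ * _]mulrC; congr (_ / _).
by rewrite /pdet; ring.
Qed.

Lemma moebius_dist_moebius x y :
  moebius_dist (moebius x) (moebius y) = moebius_dist x y.
Proof.
have [k k0 kE] := prep_moebius x; have [l l0 lE] := prep_moebius y.
rewrite /moebius_dist -(pdist_mact (prep x) (prep y) det_neq0) kE lE.
by rewrite pdist_scale.
Qed.

(** All points are moved equally far by phi^n, since x is absent on the right. *)
Lemma moebius_dist_iter x n :
  moebius_dist x (iter n moebius x) = (lucas n).1 ^+ 2 / D ^+ n.
Proof.
rewrite -(@pdist_lucas _ _ _ _ _ n (prep x)) // ?fixform_prep //.
have [k k0 ->] : exists2 k, k != 0 &
    lucas_vec a b c d n (prep x) = pscale k (prep (iter n moebius x)).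
  elim: n => [|n [k k0 IHn]].
    exists 1; first exact: oner_neq0.
    by rewrite /lucas_vec /pscale /= !mul0r !add0r.
  have [l l0 lE] := prep_moebius (iter n moebius x).
  exists (k * l); first by rewrite mulf_neq0.
  rewrite lucas_vecS IHn iterS; move: lE; rewrite /mact /pscale /= => -[e1 e2].
  by congr pair; rewrite -mulrA -?e1 -?e2; ring.
have -> : prep x = pscale 1 (prep x).
  by case: (prep x) => s t; rewrite /pscale !mul1r.
by rewrite pdist_scale ?oner_neq0 // /pscale /= !mul1r; case: (x).
Qed.

(** A zero discriminant would make T/2 an eigenvalue. *)
Lemma moebius_discr_neq0 : (2 : F) != 0 -> T ^+ 2 - 4 * D != 0.
Proof.
move=> two0; apply: contraNneq (moebius_charpoly (T / 2)) => D0.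
apply/eqP; transitivity (- (T ^+ 2 - 4 * D) / 4).
  by field; rewrite two0 -[4]/(2 * 2)%:R natrM mulf_neq0.
by rewrite D0 oppr0 mul0r.
Qed.

End ProjectiveLine.

(** * The invariant ultrametric and return times over Q_p *)

Section PadicMoebius.
Variables (p : nat) (p_pr : prime p).
Local Notation Zp := (padic_int p_pr).
Variables (Qp : fieldType) (iota : {rmorphism Zp -> Qp}).
Hypothesis iota_inj : injective iota.
Hypothesis iota_frac :
  forall x : Qp, exists a b : Zp, b != 0 /\ x * iota b = iota a.
Variables a b c d : Qp.
Hypothesis det_neq0 : a * d - b * c != 0.
Hypothesis no_fixed_point : forall x, moebius a b c d x <> x.
Implicit Types x y z : option Qp.

Local Notation D := (a * d - b * c).
Local Notation T := (a + d).
Local Notation phi := (moebius a b c d).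
Local Notation dist := (moebius_dist a b c d).
Local Notation fixform := (fixform a b c d).
Local Notation fixpolar := (fixpolar a b c d).
Local Notation padic_in := (padic_in iota).

(** For distinct points Q(k v + w) is a quadratic in k without roots, so Hensel's bound applies; for
    equal points the quotient is 4. *)
Lemma fixpolar_bound x z :
  padic_in 0 (fixpolar (prep x) (prep z) ^+ 2 /
              (fixform (prep x) * fixform (prep z))).
Proof.
have fx := fixform_prep det_neq0 no_fixed_point.
have [xz|xz] := EM (x = z).
  rewrite -xz; set q := fixform _; have -> : fixpolar (prep x) (prep x) = 2 * q.
    by rewrite /q /fixpolar /fixform; ring.
  have -> : (2 * q) ^+ 2 / (q * q) = iota 4.
    by rewrite rmorph_nat; field; exact: fx.
  exact: padic_in_of_int.
apply: padic_anisotropic => // k; rewrite -fixform_add; apply/eqP.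
move=> /(fixform_eq0 det_neq0 no_fixed_point)[e1 e2]; apply: xz.
apply: prep_inj; rewrite /pdet.
transitivity ((prep x).1 * (k * (prep x).2 + (prep z).2) -
  (prep x).2 * (k * (prep x).1 + (prep z).1)); first by ring.
by rewrite e1 e2 !mulr0 subr0.
Qed.

Definition moebius_close j x y := padic_in j (dist x y).

(** The square of the cross term lies in p^(2j) Z_p, hence the cross term in p^j Z_p. *)
Lemma moebius_close_trans j x y z :
  moebius_close j x y -> moebius_close j y z -> moebius_close j x z.
Proof.
rewrite /moebius_close => xy yz.
have fx := fixform_prep det_neq0 no_fixed_point.
have [e] := pdist_triple (fx x) (fx y) (fx z).
rewrite -!/(dist _ _) => -> eE; apply: padic_inD; first exact: padic_inD.
apply: (padic_in_sqr iota_inj iota_frac); rewrite eE -[(j + j)%N]addn0.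
by apply: padic_inM (fixpolar_bound _ _); exact: padic_inM.
Qed.

(** The characteristic polynomial has no root, so |T|^2 <= |D|. *)
Lemma moebius_trace_integral : exists t : Zp, T ^+ 2 / D - 2 = iota t.
Proof.
have [k|z zE] := @padic_anisotropic p p_pr Qp iota iota_inj iota_frac 1 (- T) D
    (oner_neq0 _) det_neq0.
  rewrite mul1r mulNr; exact: moebius_charpoly.
exists (z - 2); rewrite rmorphB rmorph_nat; congr (_ - _).
by move: zE; rewrite sqrrN mul1r expr0 mul1r.
Qed.

(* If x ^ 2 - t x + 1 had a root r in Z_p, then r T / (r + 1) would be an
   eigenvalue of the matrix of phi. *)
Lemma cheb_p1 (t : Zp) : T ^+ 2 / D - 2 = iota t ->
  exists e, cheb t p.+1 = 2 + p%:R * e.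
Proof.
move=> tE; have [t1|[r r_root r2]] := cheb_Fp p_pr (padic_red t).
  have [|e eE] := (padic_red_eq0P (cheb t p.+1 - 2)).1.
    by rewrite rmorphB cheb_morph rmorph_nat [cheb _ _]t1 subrr.
  by exists e; rewrite -eE addrC subrK.
have [s sr s_root] := padic_simple_root r_root r2.
(* If s were -1, its residue r would satisfy r^2 = 1. *)
have s1 : iota s + 1 != 0.
  rewrite -(rmorph1 iota) -rmorphD -[X in _ != X](rmorph0 iota).
  apply: contra r2 => /eqP/iota_inj/(congr1 (@padic_red p p_pr)).
  rewrite rmorphD rmorph1 rmorph0 /= sr => /eqP.
  by rewrite addr_eq0 => /eqP ->; rewrite sqrrN expr1n.
have := moebius_charpoly det_neq0 no_fixed_point (iota s * T / (iota s + 1)).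
case/eqP.
have sE : iota s ^+ 2 - (T ^+ 2 / D - 2) * iota s + 1 = 0.
  rewrite tE -rmorphXn -rmorphM -rmorphB -(rmorph1 iota) -rmorphD s_root.
  exact: rmorph0.
move: (iota s) s1 sE => u u1 uE.
transitivity (D / (u + 1) ^+ 2 * (u ^+ 2 - (T ^+ 2 / D - 2) * u + 1)).
  by field; rewrite u1 det_neq0.
by rewrite uE mulr0.
Qed.

(** In the expansion at 2 with [n = p], the linear term gains p^2 and the quadratic term is
    divisible by p^(2s+2). *)
Lemma cheb_return (t : Zp) s : T ^+ 2 / D - 2 = iota t ->
  exists e, cheb t (p.+1 * p ^ s) = 2 + p%:R ^+ s.+1 * e.
Proof.
move=> tE; elim: s => [|s [e IHs]].
  by rewrite muln1 expr1; exact: cheb_p1.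
rewrite expnSr mulnA -cheb_comp IHs.
have [r ->] := cheb_near2 (p%:R ^+ s.+1 * e) p.
exists (p%:R * e + p%:R ^+ s * e ^+ 2 * r).
by rewrite !exprS; ring.
Qed.

Lemma moebius_close_decr i j x y :
  (i <= j)%N -> moebius_close j x y -> moebius_close i x y.
Proof. exact: padic_in_le. Qed.

Lemma moebius_close_sym j x y : moebius_close j x y -> moebius_close j y x.
Proof. by rewrite /moebius_close moebius_dist_sym. Qed.

Lemma moebius_close_moebius j x y :
  moebius_close j x y -> moebius_close j (phi x) (phi y).
Proof. by rewrite /moebius_close moebius_dist_moebius. Qed.

Lemma moebius_close_sep x y : (forall j, moebius_close j x y) -> x = y.
Proof.
by move/(padic_in_sep iota_inj iota_frac); exact: moebius_dist_eq0.
Qed.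

Lemma moebius_close_refl j x : moebius_close j x x.
Proof.
rewrite /moebius_close /moebius_dist /pdist.
have -> : pdet (prep x) (prep x) = 0 by rewrite /pdet; ring.
by rewrite expr0n mul0r; exact: padic_in0.
Qed.

Lemma moebius_close_iter j x y n :
  moebius_close j x (iter n phi x) -> moebius_close j y (iter n phi y).
Proof. by rewrite /moebius_close !moebius_dist_iter. Qed.

Lemma moebius_return j :
  exists s, moebius_close j None (iter ((p + 1) * p ^ s) phi None).
Proof.
have [t tE] := moebius_trace_integral.
have D2 : T ^+ 2 - 4 * D != 0.
  by apply: moebius_discr_neq0 => //; exact: (padic_natr_neq0 iota_inj).
(* The m extra factors of p absorb the division by the discriminant. *)
have [m mP] := padic_small iota_inj iota_frac (T ^+ 2 - 4 * D)^-1.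
exists (m + j)%N; have [e eE] := cheb_return (m + j) tE.
rewrite addn1 /moebius_close moebius_dist_iter //.
set n := (_ * _)%N in eE *.
have := lucas_cheb n det_neq0; rewrite tE -(cheb_morph iota) eE.
rewrite rmorphD rmorph_nat [2 + _]addrC addrK rmorphM rmorphXn rmorph_nat => uE.
have -> : (lucas a b c d n).1 ^+ 2 / D ^+ n =
    p%:R ^+ (m + j).+1 * iota e / (T ^+ 2 - 4 * D).
  apply: (mulfI (expf_neq0 n det_neq0)); rewrite [LHS]mulrC divfK ?expf_neq0 //.
  by rewrite mulrA uE mulrAC mulfV // mul1r.
by apply: mP; apply: (@padic_in_le _ _ _ _ _ (m + j).+1) => //; exists e.
Qed.

Lemma moebius_scale_exists :
  (forall n, (0 < n)%N -> iter n phi <> id) ->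
  exists2 k, (0 < k)%N & [/\ (k %| p + 1)%N,
    forall s, exists j, forall x n,
      moebius_close j x (iter n phi x) -> (k * p ^ s %| n)%N &
    forall j, exists s, forall x, moebius_close j x (iter (k * p ^ s) phi x)].
Proof.
move=> inf; pose P j n := moebius_close j None (iter n phi None).
have [||||||k k_gt0 [kp kP Pk]] := @scale_exists p (p + 1) P p_pr.
- by rewrite addn1.
- by move=> j; exact: moebius_close_refl.
- by move=> i j n ij; exact: moebius_close_decr.
- move=> j m n Pm; rewrite /P addnC iterD.
  have Pm' : moebius_close j (iter n phi None) (iter n phi (iter m phi None)).
    rewrite -iterD addnC iterD; exact: moebius_close_iter Pm.
  split=> H; last exact: moebius_close_trans Pm'.
  exact: moebius_close_trans (moebius_close_sym Pm').
(* If phi^n moved infinity by less than every level, it would fix every point, contradicting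
   infinite order. *)
- move=> n n_gt0; apply/existsNP => nP; apply: (inf n n_gt0); apply/funext => x.
  apply/esym/moebius_close_sep => j; exact: moebius_close_iter (nP j).
- exact: moebius_return.
exists k => //; split=> // [s|j].
  have [j jP] := kP s; exists j => x n xn; apply: jP.
  exact: moebius_close_iter xn.
by have [s sP] := Pk j; exists s => x; exact: moebius_close_iter sP.
Qed.

(** The distance is e^2 / (A (A + h)), where h is negligible against A for small e. *)
Lemma moebius_close_near j (t : Qp) : exists n, forall e,
  padic_in n e -> moebius_close j (Some t) (Some (t + e)).
Proof.
have := fixform_prep det_neq0 no_fixed_point (Some t).
set A := fixform _ => A0.
have [m1 m1P] := padic_small iota_inj iota_frac ((2 * c * t + (d - a)) / A).
have [m2 m2P] := padic_small iota_inj iota_frac (c / A).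
have [m3 m3P] := padic_small iota_inj iota_frac (A ^- 2).
exists (m1 + m2 + m3 + j).+1 => e eE.
have e1 n : (n <= (m1 + m2 + m3 + j).+1)%N -> padic_in n e.
  by move=> ?; exact: padic_in_le eE.
have e2 n : (n <= (m1 + m2 + m3 + j).+1)%N -> padic_in n (e * e).
  move=> nN.
  exact: padic_in_le (leq_trans nN (leq_addr _ _)) (padic_inM eE eE).
pose h := e * (2 * c * t + (d - a)) + e * e * c.
have AhE : fixform (prep (Some (t + e))) = A + h.
  by rewrite /A /h /fixform /=; ring.
have : padic_in 0 (A / (A + h)).
  apply: padic_in_perturb => //; rewrite mulrDl -!(mulrA _ _ A^-1).
  apply: padic_inD; [apply: m1P; apply: e1|apply: m2P; apply: e2]; lia.
rewrite /moebius_close => Ah.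
have -> : dist (Some t) (Some (t + e)) = e * e * A ^- 2 * (A / (A + h)).
  have : A + h != 0 by rewrite -AhE; exact: fixform_prep.
  rewrite /moebius_dist /pdist AhE -/A /pdet /=.
  move: A0; move: A h {AhE m1P m2P m3P Ah} => A h A0 Ah0.
  by field; rewrite A0 Ah0.
by rewrite -[j]addn0; apply: padic_inM Ah; apply: m3P; apply: e2; lia.
Qed.

(** In the coordinate e = 1/s the distance is e^2 / (c (c + h)), with h negligible against c. *)
Lemma moebius_close_infinity j : exists m, forall s,
  ~ padic_in 0 (p%:R ^+ m * s) -> moebius_close j None (Some s).
Proof.
have c0 := moebius_c_neq0 no_fixed_point.
have [m1 m1P] := padic_small iota_inj iota_frac ((d - a) / c).
have [m2 m2P] := padic_small iota_inj iota_frac (- b / c).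
have [m3 m3P] := padic_small iota_inj iota_frac (c ^- 2).
pose N := (m1 + m2 + m3 + j).+1; exists N => s.
have [//|[ps0 ps1] _] := padic_in_or_inv iota_inj iota_frac (p%:R ^+ N * s).
have s0 : s != 0 by apply: contraNneq ps0 => ->; rewrite mulr0.
set e := s^-1.
have eE : padic_in N e.
  have := padic_inM (padic_in_pi iota N) ps1.
  rewrite invfM mulVKf ?(padic_pi_exp_neq0 iota_inj) //.
  by apply: padic_in_le; rewrite leq_addr.
have e1 n : (n <= N)%N -> padic_in n e.
  by move=> ?; exact: padic_in_le eE.
have e2 n : (n <= N)%N -> padic_in n (e * e).
  move=> nN.
  exact: padic_in_le (leq_trans nN (leq_addr _ _)) (padic_inM eE eE).
pose h := e * (d - a) + e * e * - b.
have hE : fixform (prep (Some s)) = s ^+ 2 * (c + h).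
  by rewrite /h /e /fixform /=; field.
have ch : padic_in 0 (c / (c + h)).
  apply: padic_in_perturb => //; rewrite mulrDl -!(mulrA _ _ c^-1).
  apply: padic_inD; [apply: m1P; apply: e1|apply: m2P; apply: e2]; lia.
have ch0 : c + h != 0.
  have := fixform_prep det_neq0 no_fixed_point (Some s); rewrite hE.
  by apply: contraNneq => ->; rewrite mulr0.
rewrite /moebius_close.
have -> : dist None (Some s) = e * e * c ^- 2 * (c / (c + h)).
  rewrite /moebius_dist /pdist hE /pdet /fixform /= /e.
  by field; rewrite c0 s0 ch0.
by rewrite -[j]addn0; apply: padic_inM ch; apply: m3P; apply: e2; lia.
Qed.

End PadicMoebius.

(** * Topology of the p-adic projective line *)

Section PadicTopology.
Variables (p : nat) (p_pr : prime p).
Local Notation Zp := (padic_int p_pr).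
Local Notation Qp := (padic p_pr).

Definition padic_embed : {rmorphism Zp -> Qp} := @FracField.tofrac Zp.

Lemma padic_embed_inj : injective padic_embed.
Proof. by move=> x y /eqP; rewrite tofrac_eq => /eqP. Qed.

Lemma padic_ballP (x : Qp) n (A : set Qp) :
  (forall e, padic_in padic_embed n e -> A (x + e)) -> nbhs x A.
Proof. by move=> xA; exists n => // _ [z _ <-]; apply: xA; exists z. Qed.

Lemma padic_nbhsP (x : Qp) (A : set Qp) :
  nbhs x A -> exists n, forall e, padic_in padic_embed n e -> A (x + e).
Proof. by move=> [n _ xA]; exists n => _ [z ->]; apply: xA; exists z. Qed.

(** The disk p^-m Z_p is a continuous image of Z_p; removing such disks gives neighbourhoods of
    infinity. *)
Lemma padic_disk_compact m :
  compact [set x : Qp | padic_in padic_embed 0 (p%:R ^+ m * x)].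
Proof.
have pm0 := padic_pi_exp_neq0 padic_embed_inj m.
pose g (z : Zp) : Qp := padic_embed z / p%:R ^+ m.
suff -> : [set x : Qp | padic_in padic_embed 0 (p%:R ^+ m * x)] =
    g @` [set: Zp].
  apply: continuous_compact; last exact: odometer_compact.
  apply: continuous_subspaceT => z A /padic_nbhsP[n zA].
  apply: filterS (ocoord_nbhs z (m + n)%N) => t /padic_coord_eq[y ->].
  change (A (g (z + p%:R ^+ (m + n) * y))).
  have -> : g (z + p%:R ^+ (m + n) * y) = g z + p%:R ^+ n * padic_embed y.
    rewrite /g rmorphD rmorphM rmorphXn rmorph_nat mulrDl; congr (_ + _).
    by rewrite exprD -(mulrA (p%:R ^+ m)) mulrAC mulfV // mul1r.
  by apply: zA; exists y.
apply/seteqP; split=> x /=.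
  move=> [z]; rewrite expr0 mul1r => zE; exists z => //.
  by rewrite /g -zE mulrC mulKf.
move=> [z _ <-]; rewrite /g mulrCA mulfV // mulr1.
exact: padic_in_of_int.
Qed.

(** The disk is a subgroup containing Z_p, so it contains every y that differs from one of its
    points by an element of Z_p. *)
Lemma padic_disk_closed m :
  closed [set x : Qp | padic_in padic_embed 0 (p%:R ^+ m * x)].
Proof.
move=> y /(_ [set x | padic_in padic_embed 0 (x - y)]) [|x [/= xC xy]].
  by apply: (@padic_ballP _ 0) => e /=; rewrite addrC addKr.
have -> : y = x - (x - y) by rewrite subKr.
rewrite mulrBr; apply: padic_inD => //; apply: padic_inN.
apply: (@padic_in_le _ _ _ _ _ (m + 0)) => //.
exact: padic_inM (padic_in_pi _ _) xy.
Qed.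

End PadicTopology.

Theorem theorem1p2 (p : nat) (p_pr : prime p) (a b c d : padic p_pr)
    (det_neq0 : a * d - b * c != 0)
    (no_fixed_point : forall x : padic_P1 p_pr, homography a b c d x <> x)
    (infinite_order : forall n : nat, (0 < n)%N ->
       iter n (homography a b c d) <> id) :
  exists (k : nat) (q : odometer_scale),
    [/\ (k %| p + 1)%N,
        forall s : nat, q s = (k * p ^ s)%N
      & forall E : set (padic_P1 p_pr),
          minimal_subsystem (homography a b c d) E ->
          topologically_conjugate E (homography a b c d)
            [set: odometer q] (@adding_machine q)].
Proof.
have inj := @padic_embed_inj p p_pr.
have frac := @fractionP (padic_int p_pr).
have [k k_gt0 [kp kP Pk]] :=
  @moebius_scale_exists p p_pr (padic p_pr) (padic_embed p_pr) inj frac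
    a b c d det_neq0 no_fixed_point infinite_order.
have q_gt0 s : (0 < k * p ^ s)%N by rewrite muln_gt0 k_gt0 expn_gt0 prime_gt0.
have q_dvd s : (k * p ^ s %| k * p ^ s.+1)%N.
  by rewrite dvdn_pmul2l // dvdn_exp2l.
exists k, (OdometerScale q_gt0 q_dvd); split=> // E.
apply: (@conjugate_odometer (padic_P1 p_pr) (homography a b c d)
  (moebius_close (padic_embed p_pr) a b c d)) => //.
- exact: moebius_close_sym.
- exact: (moebius_close_trans inj frac det_neq0 no_fixed_point).
- by move=> i j x y; exact: moebius_close_decr.
- exact: (moebius_close_moebius det_neq0 no_fixed_point).
(* Classes of the relation are neighbourhoods: a ball around a finite t, the complement of a disk at
   infinity. *)
- move=> j [t|].
    have [n nP] := moebius_close_near inj frac det_neq0 no_fixed_point j t.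
    exact: (@padic_ballP _ _ t n
      [set s | moebius_close _ a b c d j (Some t) (Some s)]).
  have [m mP] := moebius_close_infinity inj frac det_neq0 no_fixed_point j.
  exists [set x | padic_in (padic_embed p_pr) 0 (p%:R ^+ m * x)].
    by split; [exact: padic_disk_compact|exact: padic_disk_closed].
  move=> _ [[s /= /mP sm <-] //|-> /=].
  exact: moebius_close_refl.
- exact: (moebius_close_sep inj frac det_neq0 no_fixed_point).
Qed.
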